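(* Let $X\subset\mathbb{R}^2$ be a finite set in convex position, not contained in a line. Then $$\mathcal{M}_X=\bigcap\{\mathcal{M}_{\{a,b,c\}} : abc \text{ is a tallest triangle of } X\}.$$
   Context: A set $S\subset\mathbb{R}^2$ is in convex position if every point of $S$ lies on the boundary of $\mathrm{conv}(S)$. For a point set $X$ and a point $O$, $X_O=2O-X$; $O$ is an admissible center for $X$ if $X\cup X_O$ is in convex position, and $\mathcal{M}_X$ is the set of all admissible centers for $X$. For a finite set $X$ in convex position not contained in a line, a side $ab$ of $X$ is a pair of points $a,b\in X$ that are consecutive among the points of $X$ along the boundary of $\mathrm{conv}(X)$ (so the segment $ab$ lies on the boundary of $\mathrm{conv}(X)$). If $ab$ is a side and $c\in X$ is a point of $X$ at maximal distance from the line $ab$, then $abc$ is called a tallest triangle of $X$ with respect to the side $ab$. *)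

(* Defs.v *)
From HB Require Import structures.
From mathcomp Require Import all_boot all_order all_algebra.
Set Implicit Arguments. Unset Strict Implicit. Unset Printing Implicit Defensive.
Import Order.TTheory GRing.Theory Num.Theory.
Local Open Scope ring_scope.

Section Defs.
Variable R : rcfType.
Notation pt := (R * R)%type.

Definition dist2 (p q : pt) : R := (p.1 - q.1) ^+ 2 + (p.2 - q.2) ^+ 2.

Definition conv (S : seq pt) (p : pt) : Prop :=
  exists w : 'I_(size S) -> R,
    (forall i, 0 <= w i) /\ \sum_i w i = 1 /\
    p.1 = \sum_i w i * (nth (0, 0) S i).1 /\
    p.2 = \sum_i w i * (nth (0, 0) S i).2.

Definition interior (A : pt -> Prop) (p : pt) : Prop :=
  exists eps : R, 0 < eps /\ forall q, dist2 p q < eps -> A q.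
Definition closure (A : pt -> Prop) (p : pt) : Prop :=
  forall eps : R, 0 < eps -> exists q, A q /\ dist2 p q < eps.
Definition boundary (A : pt -> Prop) (p : pt) : Prop :=
  closure A p /\ ~ interior A p.

Definition convex_position (S : seq pt) : Prop :=
  forall p, p \in S -> boundary (conv S) p.

Definition refl_set (O : pt) (X : seq pt) : seq pt :=
  map (fun x => (2 * O.1 - x.1, 2 * O.2 - x.2)) X.

Definition admissible (X : seq pt) (O : pt) : Prop :=
  convex_position (X ++ refl_set O X).

Definition collinear (X : seq pt) : Prop :=
  exists a b c : R, (a != 0 \/ b != 0) /\
    forall p, p \in X -> a * p.1 + b * p.2 = c.

Definition cross (a b p : pt) : R :=
  (b.1 - a.1) * (p.2 - a.2) - (b.2 - a.2) * (p.1 - a.1).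

(* ab is a side of X: a, b are distinct points of X consecutive along the
   boundary of conv X, i.e. all of X lies (weakly) on one side of the line ab
   (so segment ab is on the boundary of conv X) and no other point of X lies
   strictly between a and b on that segment. *)
Definition side (X : seq pt) (a b : pt) : Prop :=
  [/\ a \in X, b \in X, a != b,
      ((forall p, p \in X -> 0 <= cross a b p) \/
       (forall p, p \in X -> cross a b p <= 0)) &
      ~ (exists p, p \in X /\ exists t : R, 0 < t < 1 /\
            p = (a.1 + t * (b.1 - a.1), a.2 + t * (b.2 - a.2)))].

Definition dist_line (a b p : pt) : R :=
  `|cross a b p| / Num.sqrt (dist2 a b).

Definition tallest (X : seq pt) (a b c : pt) : Prop :=
  side X a b /\ c \in X /\
  forall p, p \in X -> dist_line a b p <= dist_line a b c.

End Defs.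

(* Main.v *)
Require Import Defs.
From HB Require Import structures.
From mathcomp Require Import all_boot all_order all_algebra.
From mathcomp Require Import ring lra.
Import Order.TTheory GRing.Theory Num.Theory.
Local Open Scope ring_scope.

(** Write [d = 2 O - p] for the reflection of a point [p] of [X].  Since a point
    of a planar hull is a boundary point exactly when it maximises some nonzero
    linear functional, admissibility passes to subsets, which is one inclusion.
    Conversely, suppose that [p] is interior to the hull of [X] and its
    reflection, and let [r], [l] be the neighbours of [p] and [q1], [q2] tallest
    points over the sides [pr], [pl].  If the triangles [p r q1] and [p l q2]
    admit [O], then the ray from [p] to [d] separates [q1] from [q2], so it
    leaves the hull of [X] through a side [xy] over which [p] is tallest.  As no
    functional maximal at [p] survives the reflection, [d] lies strictly below
    the line [xy], and the triangle [x y p] does not admit [O]. *)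

Section TallestTriangles.
Variable R : rcfType.
Notation pt := (R * R)%type.
Implicit Types (S X : seq pt) (a b c d p q r x y z O u v : pt).

(** * Finite extrema and angular order around a point *)

Definition dot u v : R := u.1 * v.1 + u.2 * v.2.

Lemma seq_argmax (T : eqType) (F : T -> R) (s : seq T) (t0 : T) :
  t0 \in s -> exists2 x : T, x \in s & forall y : T, y \in s -> F y <= F x.
Proof.
move=> t0s; have {t0s} : s != [::] by case: s t0s.
elim: s => [//|x s IH] _; case: (eqVneq s [::]) => [->|/IH [m ms mP]].
  by exists x; rewrite ?mem_head // => y; rewrite inE => /eqP ->.
case: (lerP (F x) (F m)) => h.
  by exists m; rewrite ?inE ?ms ?orbT // => y; rewrite inE => /predU1P[->|/mP].
exists x; rewrite ?mem_head // => y; rewrite inE => /predU1P[->//|/mP hy].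
exact: le_trans hy (ltW h).
Qed.

(* In an open half-plane of directions seen from [p], points are linearly
   preordered by the cotangent of their angle with the bounding line. *)
Lemma angular_extreme (sg : R) v p (L : seq pt) z0 :
  z0 \in L -> (forall z, z \in L -> (z.1 - p.1) * v.2 - (z.2 - p.2) * v.1 < 0) ->
  exists2 y, y \in L & forall z, z \in L -> 0 <= sg * cross p y z.
Proof.
move=> z0L Lv.
pose f z := (z.1 - p.1) * v.2 - (z.2 - p.2) * v.1.
pose g z := (z.1 - p.1) * v.1 + (z.2 - p.2) * v.2.
have [y yL ymax] := seq_argmax _ (fun z => - (sg * (g z / f z))) _ _ z0L.
exists y => // z zL.
have fy : f y < 0 := Lv y yL.
have fz : f z < 0 := Lv z zL.
have N0 : 0 < v.1 ^+ 2 + v.2 ^+ 2.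
  rewrite lt0r addr_ge0 ?sqr_ge0 // andbT paddr_eq0 ?sqr_ge0 // !sqrf_eq0.
  apply/negP => /andP[/eqP v1 /eqP v2].
  by move: fy; rewrite /f v1 v2 !mulr0 subr0 ltxx.
have le := ymax z zL.
have fyz : 0 < f y * f z by nra.
rewrite -(pmulr_rge0 _ N0).
have -> : (v.1 ^+ 2 + v.2 ^+ 2) * (sg * cross p y z) =
          f y * f z * (sg * (g z / f z) - sg * (g y / f y)).
  have fy0 : f y != 0 by rewrite lt_eqF.
  have fz0 : f z != 0 by rewrite lt_eqF.
  have -> : f y * f z * (sg * (g z / f z) - sg * (g y / f y)) =
            sg * (f y * g z - g y * f z) by field; rewrite fy0 fz0.
  by rewrite /f /g /cross; ring.
by rewrite pmulr_rge0 // subr_ge0 -lerN2.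
Qed.

(** * Convex hulls, and interior points described by linear functionals *)

Lemma conv_mem S z : z \in S -> conv S z.
Proof.
move=> zS; have hi : (index z S < size S)%N by rewrite index_mem.
pose i0 := Ordinal hi.
exists (fun i => (i == i0)%:R); split; first by move=> i; rewrite ler0n.
have sumE (F : 'I_(size S) -> R) : \sum_i (i == i0)%:R * F i = F i0.
  rewrite (bigD1 i0) //= eqxx mul1r big1 ?addr0 // => i /negbTE ->.
  by rewrite mul0r.
split; last by rewrite !sumE /= nth_index.
by rewrite -[RHS](sumE (fun=> 1)); apply: eq_bigr => i _; rewrite mulr1.
Qed.

Lemma conv_segment S a b (t : R) q : conv S a -> conv S b -> 0 <= t <= 1 ->
  q.1 = (1 - t) * a.1 + t * b.1 -> q.2 = (1 - t) * a.2 + t * b.2 -> conv S q.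
Proof.
move=> [w [w0 [w1 [wa1 wa2]]]] [w' [w'0 [w'1 [wb1 wb2]]]] /andP[t0 t1] q1 q2.
exists (fun i => (1 - t) * w i + t * w' i); split.
  by move=> i; rewrite addr_ge0 // mulr_ge0 // subr_ge0.
have E (F : 'I_(size S) -> R) : \sum_i ((1 - t) * w i + t * w' i) * F i =
    (1 - t) * (\sum_i w i * F i) + t * \sum_i w' i * F i.
  rewrite !mulr_sumr -big_split /=; apply: eq_bigr => i _.
  by rewrite mulrDl !mulrA.
rewrite !E -wa1 -wb1 -wa2 -wb2; split=> //.
by rewrite big_split -!mulr_sumr w1 w'1 /=; ring.
Qed.

Lemma conv_dot_le S u p q :
  (forall z, z \in S -> dot u z <= dot u p) -> conv S q -> dot u q <= dot u p.
Proof.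
move=> up [w [w0 [w1 [q1 q2]]]].
have -> : dot u q = \sum_i w i * dot u (nth (0, 0) S i).
  rewrite /dot q1 q2 !mulr_sumr -big_split; apply: eq_bigr => i _ /=; ring.
rewrite -[leRHS]mul1r -w1 mulr_suml; apply: ler_sum => i _.
by rewrite ler_wpM2l // up // mem_nth.
Qed.

Lemma interior_conv_dot S p u : interior (conv S) p -> u != (0, 0) ->
  has (fun z => dot u p < dot u z) S.
Proof.
move=> [e [e0 ball]] u0; apply/negPn; rewrite -all_predC.
apply/negP => /allP us.
have N0 : 0 < dot u u.
  rewrite /dot -!expr2 lt0r addr_ge0 ?sqr_ge0 // andbT.
  rewrite paddr_eq0 ?sqr_ge0 // !sqrf_eq0.
  by case: u u0 {us} => u1 u2 /=.
set N := dot u u in N0.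
(* This choice gives [s < 1] and [s * N < e], so moving [p] by [s] times [u] costs squared distance
   [s ^+ 2 * N < e], without any square root. *)
pose s := e / (e + N).
have eN : 0 < e + N by rewrite addr_gt0.
have s0 : 0 < s by rewrite divr_gt0.
have sE : s * (e + N) = e by rewrite divfK // gt_eqF.
pose q : pt := (p.1 + s * u.1, p.2 + s * u.2).
have qS : conv S q.
  apply: ball; have -> : dist2 p q = s ^+ 2 * N.
    by rewrite /dist2 /q /N /dot /=; ring.
  have s1 : s < 1 by rewrite ltr_pdivrMr // mul1r; lra.
  have : s ^+ 2 * N <= s * N by rewrite ler_pM2r // expr2; nra.
  by move=> /le_lt_trans; apply; nra.
have : dot u q <= dot u p.
  by apply: conv_dot_le qS => z /us /=; rewrite -leNgt.
have -> : dot u q = dot u p + s * N by rewrite /q /N /dot /=; ring.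
have := mulr_gt0 s0 N0; lra.
Qed.

(** A segment joining points of [S] on the two sides of the line through [p] with direction [d]
    meets that line; the endpoints are chosen so that it does so ahead of [p]. *)
Lemma conv_ray S p d : d != (0, 0) ->
  (forall u, u != (0, 0) -> has (fun z => dot u p < dot u z) S) ->
  exists2 t : R, 0 < t & conv S (p.1 + t * d.1, p.2 + t * d.2).
Proof.
move=> d0 sep.
pose f z : R := (z.1 - p.1) * d.2 - (z.2 - p.2) * d.1.
have /sep/hasP[z0 z0S z0P] : ((- d.2, d.1) : pt) != (0, 0).
  by case: (d) d0 => d1 d2; rewrite !xpair_eqE oppr_eq0 andbC.
have f0 : f z0 < 0 by move: z0P; rewrite /dot /f /=; lra.
pose L := [seq z <- S | f z < 0].
have z0L : z0 \in L by rewrite mem_filter f0.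
have LP z : z \in L -> f z < 0 by rewrite mem_filter => /andP[].
(* [y] is the point left of [d] closest to [d] in angle. A point [w] strictly right of the line [py]
   exists by [sep]; it cannot be left of [d], so the segment from [y] to [w] crosses the ray. *)
have [y yL yP] := angular_extreme 1 _ _ _ _ z0L LP.
have fy := LP y yL.
have /sep/hasP[w wS wP] : ((y.2 - p.2, - (y.1 - p.1)) : pt) != (0, 0).
  rewrite xpair_eqE oppr_eq0; apply/negP => /andP[/eqP h2 /eqP h1].
  by move: fy; rewrite /f h1 h2 !mul0r subr0 ltxx.
have cw : cross p y w < 0 by move: wP; rewrite /dot /cross /=; lra.
have fw : 0 <= f w.
  rewrite leNgt; apply/negP => fw; have := yP w.
  by rewrite mem_filter fw wS mul1r => /(_ isT); lra.
have D0 : 0 < f w - f y by lra.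
have Dn0 : f w - f y != 0 by rewrite gt_eqF.
exists (- cross p y w / (f w - f y)); first by rewrite divr_gt0 ?oppr_gt0.
have yS : y \in S by move: yL; rewrite mem_filter => /andP[].
apply: (conv_segment _ y w (- f y / (f w - f y))); [exact: conv_mem|exact: conv_mem| | |].
- apply/andP; split; first by rewrite divr_ge0 ?(ltW D0) //; lra.
  by rewrite ler_pdivrMr // mul1r; lra.
- by apply: (mulIf Dn0); rewrite /= /cross; move: Dn0; rewrite /f => Dn0; field.
- by apply: (mulIf Dn0); rewrite /= /cross; move: Dn0; rewrite /f => Dn0; field.
Qed.

Lemma conv_line S p d (t t' s : R) :
  conv S (p.1 + t * d.1, p.2 + t * d.2) ->
  conv S (p.1 - t' * d.1, p.2 - t' * d.2) ->
  0 < t -> 0 < t' -> - t' <= s <= t ->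
  conv S (p.1 + s * d.1, p.2 + s * d.2).
Proof.
move=> h h' t0 t'0 /andP[s1 s2].
have T0 : 0 < t + t' by rewrite addr_gt0.
have Tn0 : t' + t != 0 by rewrite addrC gt_eqF.
apply: (conv_segment _ _ _ ((s + t') / (t' + t)) _ h' h) => /=; last 2 first.
- by field.
- by field.
rewrite addrC in T0; apply/andP; split; first by rewrite divr_ge0 ?(ltW T0) //; lra.
by rewrite ler_pdivrMr // mul1r; lra.
Qed.

(* Small horizontal and vertical segments through [p] lie in the hull, and so
   does the diamond they span. *)
Lemma interior_conv S p :
  (forall u, u != (0, 0) -> has (fun z => dot u p < dot u z) S) ->
  interior (conv S) p.
Proof.
move=> sep.
have one0 : (1 : R) != 0 by rewrite oner_eq0.
have [|t1 t10 c1] := conv_ray S p (1, 0) _ sep; first by rewrite xpair_eqE negb_and one0.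
have [|t2 t20 c2] := conv_ray S p (-1, 0) _ sep.
  by rewrite xpair_eqE negb_and oppr_eq0 one0.
have [|t3 t30 c3] := conv_ray S p (0, 1) _ sep.
  by rewrite xpair_eqE negb_and one0 orbT.
have [|t4 t40 c4] := conv_ray S p (0, -1) _ sep.
  by rewrite xpair_eqE negb_and oppr_eq0 one0 orbT.
pose t := Num.min (Num.min t1 t2) (Num.min t3 t4).
have t0 : 0 < t by rewrite !lt_min t10 t20 t30 t40.
have [tt1 tt2 tt3 tt4] : [/\ t <= t1, t <= t2, t <= t3 & t <= t4].
  by rewrite /t !ge_min !lexx /= !orbT.
exists ((t / 2) ^+ 2); split; first by rewrite exprn_gt0 // divr_gt0 // ltr0n.
move=> q; rewrite /dist2 => hq.
pose a := q.1 - p.1; pose b := q.2 - p.2.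
have ht2 : 0 <= t / 2 by lra.
have coord (s : R) : s ^+ 2 < (t / 2) ^+ 2 -> - t <= 2 * s <= t.
  move=> hs; have : `|s| < t / 2.
    by rewrite -(@ltr_pXn2r _ 2) ?nnegrE ?normr_ge0 // real_normK ?num_real.
  by rewrite ltr_norml => /andP[h1 h2]; apply/andP; lra.
have /coord /andP[a1 a2] : a ^+ 2 < (t / 2) ^+ 2.
  by apply: le_lt_trans hq; have := sqr_ge0 (p.2 - q.2); rewrite /a; nra.
have /coord /andP[b1 b2] : b ^+ 2 < (t / 2) ^+ 2.
  by apply: le_lt_trans hq; have := sqr_ge0 (p.1 - q.1); rewrite /b; nra.
(* [q] is the midpoint of the points at offsets [2 * a] and [2 * b] from [p] on the two axes, which
   is why the radius is [t / 2]. *)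
have ch : conv S (p.1 + (2 * a) * 1, p.2 + (2 * a) * 0).
  apply: (conv_line _ _ (1, 0) t1 t2) => //=; last by apply/andP; lra.
  by move: c2; rewrite /= !mulrN1 !mulr1 !mulr0 oppr0.
have cv : conv S (p.1 + (2 * b) * 0, p.2 + (2 * b) * 1).
  apply: (conv_line _ _ (0, 1) t3 t4) => //=; last by apply/andP; lra.
  by move: c4; rewrite /= !mulrN1 !mulr1 !mulr0 oppr0.
apply: (conv_segment _ _ _ (1 / 2) _ ch cv); rewrite /= /a /b; last 2 first.
- by field.
- by field.
by apply/andP; lra.
Qed.

(** * Point reflection and admissible centers *)

Definition pt_refl O z : pt := (2 * O.1 - z.1, 2 * O.2 - z.2).

Lemma pt_reflK O : involutive (pt_refl O).
Proof. by move=> [z1 z2]; rewrite /pt_refl /=; congr pair; ring. Qed.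

Lemma mem_cat_refl_set O X z :
  (z \in X ++ refl_set O X) = (z \in X) || (pt_refl O z \in X).
Proof.
rewrite mem_cat -[in X in _ || X](pt_reflK O z).
by rewrite (mem_map (inv_inj (pt_reflK O))).
Qed.

(** The doubled set is symmetric about [O]: a functional [u] at a reflected point corresponds to
    [- u] at the original one, so only the points of [X] need testing. *)
Lemma admissibleP X O : admissible X O <->
  forall p, p \in X -> ~ interior (conv (X ++ refl_set O X)) p.
Proof.
split=> [adm p pX | H p].
  by case: (adm p) => //; rewrite mem_cat pX.
rewrite mem_cat_refl_set => hp; split.
  move=> e e0; exists p; split; first by apply: conv_mem; rewrite mem_cat_refl_set.
  by rewrite /dist2 !subrr expr0n addr0.
case/orP: hp => [/H // | /H hp] /interior_conv_dot sep.
apply: hp; apply: interior_conv => -[u1 u2] u0.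
have /sep/hasP[z zS hz] : ((- u1, - u2) : pt) != (0, 0).
  by rewrite xpair_eqE !oppr_eq0 -xpair_eqE.
apply/hasP; exists (pt_refl O z).
  by move: zS; rewrite !mem_cat_refl_set pt_reflK orbC.
by move: hz; rewrite /dot /pt_refl /=; lra.
Qed.

Lemma admissible_subset X T O :
  {subset T <= X} -> admissible X O -> admissible T O.
Proof.
move=> TX /admissibleP adm; apply/admissibleP => p pT /interior_conv_dot sep.
apply: (adm p); first exact: TX.
apply: interior_conv => u /sep/hasP[z zT hz]; apply/hasP; exists z => //.
by move: zT; rewrite !mem_cat_refl_set => /orP[] /TX ->; rewrite ?orbT.
Qed.

(* With [d = 2 O - p], the hypotheses say that the barycentric coordinates of
   [O] at [q] and [r] are smaller than 1/2 and the one at [p] is larger. *)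
Lemma triangle_not_admissible (T : seq pt) O p q r (sg : R) :
  let d := pt_refl O p in
  [/\ p \in T, q \in T & r \in T] ->
  0 < sg * cross p r q -> sg * cross p r d < sg * cross p r q ->
  sg * cross p d q < sg * cross p r q ->
  sg * (cross p r d + cross p d q) < sg * cross p r q ->
  ~ admissible T O.
Proof.
move=> d [pT qT rT] K0 hG hB hBG /admissibleP adm; apply: (adm p) => //.
apply: interior_conv => u u0; apply/negPn; rewrite -all_predC.
apply/negP => /allP us.
have us' z : z \in T -> dot u z <= dot u p /\ dot u (pt_refl O z) <= dot u p.
  move=> zT; split; rewrite leNgt; apply: us.
    by rewrite mem_cat_refl_set zT.
  by rewrite mem_cat_refl_set pt_reflK zT orbT.
have [r1 r2] := us' r rT; have [q1 q2] := us' q qT.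
pose al := dot u r - dot u p; pose be := dot u q - dot u p.
pose G := sg * cross p r d; pose B := sg * cross p d q.
pose k := sg * cross p r q.
have {}K0 : 0 < k by [].
have {}hG : G < k by [].
have {}hB : B < k by [].
have {}hBG : B + G < k by move: hBG; rewrite mulrDr addrC.
have E : k * (dot u d - dot u p) = B * al + G * be.
  by rewrite /k /B /al /G /be /dot /cross; ring.
have dE z : dot u (pt_refl O z) = dot u d + dot u p - dot u z.
  by rewrite /d /dot /pt_refl /=; ring.
have al0 : al <= 0 by rewrite /al; lra.
have be0 : be <= 0 by rewrite /be; lra.
have Eal : B * al + G * be <= k * al.
  by rewrite -E ler_pM2l // /al; move: r2; rewrite dE; lra.
have Ebe : B * al + G * be <= k * be.
  by rewrite -E ler_pM2l // /be; move: q2; rewrite dE; lra.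
(* If [G] or [B] is nonpositive, one of [Eal], [Ebe] makes its variable vanish and the other
   follows. If both are positive, eliminating [al] leaves [k * (k - B - G) * be >= 0]. *)
have [alz bez] : al = 0 /\ be = 0.
  clear - al0 be0 Eal Ebe K0 hG hB hBG.
  case: (lerP G 0) => G0.
    have al1 : al = 0 by apply/le_anti; rewrite al0 /=; nra.
    by split=> //; apply/le_anti; rewrite be0 /=; move: Ebe; rewrite al1; nra.
  case: (lerP B 0) => B0.
    have be1 : be = 0 by apply/le_anti; rewrite be0 /=; nra.
    by split=> //; apply/le_anti; rewrite al0 /=; move: Eal; rewrite be1; nra.
  have be1 : be = 0.
    apply/le_anti; rewrite be0 /=.
    have h1 : (k - B) * (k - G) * be >= (k - B) * (B * al) by nra.
    have h2 : B * ((k - B) * al) >= B * (G * be) by nra.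
    have h3 : (k * (k - B - G)) * be >= 0 by lra.
    have h4 : 0 < k * (k - B - G) by rewrite mulr_gt0 //; lra.
    by rewrite -(pmulr_rge0 _ h4).
  by split=> //; apply/le_anti; rewrite al0 /=; move: Eal; rewrite be1; nra.
have kn0 : k != 0 by rewrite gt_eqF.
(* Cramer's rule recovers [u] from its values on the independent vectors [r - p] and [q - p]; both
   values are 0, so [u] vanishes. *)
have u1 : k * u.1 = sg * (al * (q.2 - p.2) - be * (r.2 - p.2)).
  by rewrite /k /al /be /dot /cross; ring.
have u2 : k * u.2 = sg * (be * (r.1 - p.1) - al * (q.1 - p.1)).
  by rewrite /k /al /be /dot /cross; ring.
move: u1 u2 u0; rewrite alz bez !mul0r subrr mulr0.
by case: (u) => u1 u2 /= /eqP; rewrite mulf_eq0 (negbTE kn0) /= => /eqP -> /eqP;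
  rewrite mulf_eq0 (negbTE kn0) /= => /eqP ->; rewrite eqxx.
Qed.

(** * Sides and neighbours of a point *)

Lemma tallest_max X a b c (sg : R) : sg != 0 -> side X a b -> c \in X ->
  (forall z, z \in X -> 0 <= sg * cross a b z <= sg * cross a b c) ->
  tallest X a b c.
Proof.
move=> sg0 sab cX H; split=> //; split=> // z zX.
rewrite /dist_line ler_wpM2r ?invr_ge0 ?sqrtr_ge0 //.
rewrite -(@ler_pM2l _ `|sg|) ?normr_gt0 // -!normrM.
have /andP[h1 h2] := H z zX.
by rewrite !ger0_norm // (le_trans h1).
Qed.

(* Among the points of [X] on the line [ab], take the two that are closest to
   the zero of the affine function [F z - F0] on either side. *)
Lemma side_crossing X a b v (F0 sg : R) : sg != 0 ->
  let F z := dot v z - F0 in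
  a \in X -> b \in X -> F b < 0 <= F a ->
  (forall z, z \in X -> 0 <= sg * cross a b z) ->
  exists a' b', [/\ side X a' b', F b' < 0 <= F a', F a' <= F a,
     cross a b a' = 0 & exists2 k : R, 0 < k & forall z, cross a' b' z = k * cross a b z].
Proof.
move=> sg0 F aX bX /andP[Fb Fa] ab.
pose LA := [seq z <- X | (cross a b z == 0) && (0 <= F z)].
pose LB := [seq z <- X | (cross a b z == 0) && (F z < 0)].
have aL : a \in LA by rewrite mem_filter aX Fa !andbT /cross; apply/eqP; ring.
have bL : b \in LB by rewrite mem_filter bX Fb !andbT /cross; apply/eqP; ring.
have [a' a'L a'P] := seq_argmax _ (fun z => - F z) _ _ aL.
have [b' b'L b'P] := seq_argmax _ F _ _ bL.
move: (a'L) (b'L); rewrite !mem_filter => /andP[/andP[/eqP ca Fa'] a'X].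
move=> /andP[/andP[/eqP cb Fb'] b'X].
have Dn0 : F b - F a != 0 by rewrite lt_eqF //; lra.
have D'n0 : F b' - F a' != 0 by rewrite lt_eqF //; lra.
have lineE z : cross a b z = 0 ->
    z.1 - a.1 = (F z - F a) / (F b - F a) * (b.1 - a.1) /\
    z.2 - a.2 = (F z - F a) / (F b - F a) * (b.2 - a.2).
  move=> cz; split; apply: (mulfI Dn0); rewrite [RHS]mulrA mulrCA divff // mulr1.
    apply/eqP; rewrite -subr_eq0; apply/eqP; transitivity (- v.2 * cross a b z).
      by rewrite /F /dot /cross; ring.
    by rewrite cz mulr0.
  apply/eqP; rewrite -subr_eq0; apply/eqP; transitivity (v.1 * cross a b z).
    by rewrite /F /dot /cross; ring.
  by rewrite cz mulr0.
(* [F] is an affine coordinate on the line [ab] that decreases both from [a] to [b] and from [a'] to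
   [b'], so the change of endpoints keeps the orientation. *)
have crossE z : cross a' b' z = (F b' - F a') / (F b - F a) * cross a b z.
  have [a1 a2] := lineE a' ca; have [b1 b2] := lineE b' cb.
  have {}a1 : a'.1 = a.1 + (F a' - F a) / (F b - F a) * (b.1 - a.1) by rewrite -a1; ring.
  have {}a2 : a'.2 = a.2 + (F a' - F a) / (F b - F a) * (b.2 - a.2) by rewrite -a2; ring.
  have {}b1 : b'.1 = a.1 + (F b' - F a) / (F b - F a) * (b.1 - a.1) by rewrite -b1; ring.
  have {}b2 : b'.2 = a.2 + (F b' - F a) / (F b - F a) * (b.2 - a.2) by rewrite -b2; ring.
  rewrite /cross a1 a2 b1 b2.
  by move: (F a') (F b') (F a) (F b) Dn0 => fa' fb' fa fb Dn0; field.
have k0 : 0 < (F b' - F a') / (F b - F a).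
  by rewrite -mulrNN -invrN divr_gt0 //; lra.
exists a', b'; split=> //; last 1 first.
- by exists ((F b' - F a') / (F b - F a)).
- split=> //.
  + by apply: contraNneq D'n0 => ->; rewrite subrr.
  + case: (ltgtP sg 0) (sg0) => // sgs _; [right|left] => z zX; have := ab z zX;
      rewrite crossE; move: (cross a b z) k0 sgs; clear; move: (_ / _) => k w; nra.
  + move=> [z [zX [t [/andP[t0 t1] zE]]]].
    have Fz : F z = F a' + t * (F b' - F a') by rewrite zE /F /dot /=; ring.
    have cz : cross a b z == 0.
      apply/eqP; transitivity ((1 - t) * cross a b a' + t * cross a b b').
        by rewrite zE /cross /=; ring.
      by rewrite ca cb !mulr0 addr0.
    (* A point of [X] strictly between [a'] and [b'] would be closer to the zero of [F] than the
       endpoint with the same sign. *)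
    case: (lerP 0 (F z)) => Fz0.
      have := a'P z; rewrite mem_filter cz Fz0 zX => /(_ isT); rewrite Fz.
      by move: (F a') (F b') Fa' Fb' t0 t1; clear; intros; nra.
    have := b'P z; rewrite mem_filter cz Fz0 zX => /(_ isT); rewrite Fz.
    by move: (F a') (F b') Fa' Fb' t0 t1; clear; intros; nra.
- by rewrite Fb' Fa'.
- by have := a'P a aL; rewrite lerN2.
Qed.

Lemma normal_neq0 p r : p != r -> (r.2 - p.2 != 0) || (r.1 - p.1 != 0).
Proof.
rewrite -negb_and; apply: contraNN => /andP[/eqP h2 /eqP h1].
by case: p r h1 h2 => [p1 p2] [r1 r2] /= h1 h2; apply/eqP; congr pair; lra.
Qed.

Lemma cross0_collinear X a b : a != b ->
  (forall z, z \in X -> cross a b z = 0) -> collinear X.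
Proof.
move=> ab H; exists (- (b.2 - a.2)), (b.1 - a.1).
exists (- (b.2 - a.2) * a.1 + (b.1 - a.1) * a.2); split.
  by have /orP[h|h] := normal_neq0 _ _ ab; [left; rewrite oppr_eq0|right].
by move=> z /H; rewrite /cross; lra.
Qed.

(** The neighbour is a point of extreme angle seen from [p], and the nearest to [p] in that
    direction; the sign of [sg] selects which of the two extremes. *)
Lemma side_neighbour X p u (sg : R) : ~ collinear X -> p \in X -> u != (0, 0) ->
  (forall z, z \in X -> dot u z <= dot u p) -> sg != 0 ->
  exists r, side X p r /\ forall z, z \in X -> 0 <= sg * cross p r z.
Proof.
move=> ncol pX u0 up sg0.
suff [r0 [r0X r0p r0P]] : exists r0, [/\ r0 \in X, p != r0 &
    forall z, z \in X -> 0 <= sg * cross p r0 z].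
  have N0 : 0 < dot (r0.1 - p.1, r0.2 - p.2) (r0.1 - p.1, r0.2 - p.2).
    rewrite /dot /= -!expr2 lt0r addr_ge0 ?sqr_ge0 // andbT.
    by rewrite paddr_eq0 ?sqr_ge0 // !sqrf_eq0 negb_and orbC normal_neq0.
  (* With this [v] the affine function vanishes at [p] and is negative at [r0], so the first
     endpoint given by [side_crossing] is squeezed to [p]. *)
  pose v : pt := (p.1 - r0.1, p.2 - r0.2).
  have [|a' [b' [sab' /andP[_ Fa'] Fap ca [k k0 kE]]]] :=
    side_crossing X p r0 v (dot v p) sg sg0 pX r0X _ r0P.
    by rewrite subrr lexx andbT; move: N0; rewrite /v /dot /=; lra.
  have Fa0 : dot v a' - dot v p = 0 by apply/le_anti; rewrite Fa' andbT subrr in Fap *.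
  have ap : a' = p.
    pose N := dot (r0.1 - p.1, r0.2 - p.2) (r0.1 - p.1, r0.2 - p.2).
    have Nn0 : N != 0 by rewrite gt_eqF.
    have e1 : N * (a'.1 - p.1) = 0.
      transitivity (- (r0.1 - p.1) * (dot v a' - dot v p) - (r0.2 - p.2) * cross p r0 a').
        by rewrite /N /v /dot /cross /=; ring.
      by rewrite Fa0 ca !mulr0 subrr.
    have e2 : N * (a'.2 - p.2) = 0.
      transitivity (- (r0.2 - p.2) * (dot v a' - dot v p) + (r0.1 - p.1) * cross p r0 a').
        by rewrite /N /v /dot /cross /=; ring.
      by rewrite Fa0 ca !mulr0 addr0.
    move/eqP: e1; move/eqP: e2; rewrite !mulf_eq0 (negbTE Nn0) /= !subr_eq0.
    by case: (a') (p) => [? ?] [? ?] /= /eqP -> /eqP ->.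
  exists b'; rewrite -ap; split=> // z zX.
  by rewrite kE mulrCA mulr_ge0 ?r0P // ltW.
pose L := [seq z <- X | dot u z < dot u p].
have LE z : (z \in L) = (dot u z < dot u p) && (z \in X) by rewrite mem_filter.
have /hasP[z0 z0X z0P] : has (fun z => dot u z < dot u p) X.
  apply/negPn; rewrite -all_predC; apply/negP => /allP al; apply: ncol.
  exists u.1, u.2, (dot u p); split.
    by case: (u) u0 => u1 u2; rewrite xpair_eqE negb_and => /orP.
  by move=> z zX; apply/le_anti; have := al z zX; rewrite /= -leNgt => ->; rewrite up.
have z0L : z0 \in L by rewrite LE z0P.
have [|y yL yP] := angular_extreme sg (- u.2, u.1) p _ _ z0L.
  by move=> z; rewrite LE /dot => /andP[h _] /=; lra.
move: yL; rewrite LE => /andP[uy yX].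
(* [y] is extreme only among points strictly below the supporting line of [u]. A point [x] violating
   it lies on that supporting line, so [px] is the supporting line itself. *)
case: (boolP (has (fun z => sg * cross p y z < 0) X)) => [/hasP[x xX xP]|]; last first.
  rewrite -all_predC => /allP al; exists y; split=> //.
    by apply: contraTneq uy => ->; rewrite ltxx.
  by move=> z /al /=; rewrite -leNgt.
have ux : dot u x = dot u p.
  apply/le_anti; rewrite up //= leNgt; apply/negP => ux.
  by have := yP x; rewrite LE ux xX => /(_ isT); rewrite leNgt xP.
exists x; split=> //.
  by apply: contraTneq xP => <-; rewrite -leNgt /cross; lra.
move=> z zX.
have E : (dot u p - dot u y) * (sg * cross p x z) =
         (dot u p - dot u z) * (- (sg * cross p y x)).
  apply/eqP; rewrite -subr_eq0; apply/eqP.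
  transitivity ((dot u p - dot u x) * sg * cross p y z).
    by rewrite /dot /cross; ring.
  by rewrite ux subrr !mul0r.
have k0 : 0 < dot u p - dot u y by rewrite subr_gt0.
by rewrite -(pmulr_rge0 _ k0) E mulr_ge0 ?subr_ge0 ?up //; lra.
Qed.

(** * From tallest triangles to all of [X] *)

(** The reflection of [p] lies strictly on the side of the line [pq] containing [r]. Otherwise its
    coordinate along [r] is nonpositive, while interiority bounds the one along [q] below 1, and the
    triangle [prq] does not admit [O]. *)
Lemma tallest_corner X O p r q (sg : R) : ~ collinear X ->
  (forall a b c, tallest X a b c -> admissible [:: a; b; c] O) ->
  interior (conv (X ++ refl_set O X)) p -> sg != 0 -> side X p r ->
  (forall z, z \in X -> 0 <= sg * cross p r z) -> q \in X ->
  (forall z, z \in X -> sg * cross p r z <= sg * cross p r q) ->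
  0 < sg * cross p r q /\ sg * cross p q (pt_refl O p) < 0.
Proof.
move=> ncol adm /interior_conv_dot sep sg0 spr prP qX qmax.
have [pX rX pr _ _] := spr.
have K0 : 0 < sg * cross p r q.
  rewrite ltNge; apply/negP => K0; apply: ncol.
  apply: (cross0_collinear _ _ _ pr) => z zX.
  apply/eqP; have /eqP : sg * cross p r z = 0.
    by apply/le_anti; rewrite prP // andbT (le_trans (qmax _ zX)).
  by rewrite mulf_eq0 (negbTE sg0).
split=> //; rewrite ltNge; apply/negP => Q0.
have /sep/hasP[z zS hz] : ((sg * (r.2 - p.2), - (sg * (r.1 - p.1))) : pt) != (0, 0).
  rewrite xpair_eqE oppr_eq0 !mulf_eq0 (negbTE sg0) /= negb_and.
  exact: normal_neq0.
have G : sg * cross p r (pt_refl O p) < sg * cross p r q.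
  move: zS; rewrite mem_cat_refl_set => /orP[] zX.
    by have := prP z zX; move: hz; rewrite /dot /cross /=; lra.
  by have := qmax _ zX; move: hz; rewrite /dot /cross /pt_refl /=; lra.
have B : sg * cross p (pt_refl O p) q <= 0.
  by move: Q0; rewrite /cross; lra.
apply: (triangle_not_admissible [:: p; r; q] O p q r sg _ K0 G).
- by rewrite !inE !eqxx !orbT.
- exact: le_lt_trans B K0.
- by rewrite mulrDr; lra.
- apply: adm; apply: (tallest_max X p r q sg) => // w wX.
  by rewrite prP // qmax.
Qed.

(** The line [xy] supports [X] where the ray from [p] towards [d] leaves the hull, so the pair is
    found by maximising the exit parameter. *)
Lemma bridge X p d q1 q2 : let f z := cross p z d in
  q1 \in X -> q2 \in X -> f q1 < 0 -> 0 < f q2 -> 0 < cross p q2 q1 ->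
  exists x y, [/\ x \in X, y \in X, f y < 0 <= f x, 0 < cross p x y &
    forall z, z \in X -> 0 <= cross x y z].
Proof.
move=> f q1X q2X f1 f2 h21.
(* The point [p + t (d - p)] is where the line through the pair meets the line [pd]. *)
pose t (xy : pt * pt) := cross p xy.1 xy.2 / (f xy.1 - f xy.2).
pose LA := [seq z <- X | 0 <= f z]; pose LB := [seq z <- X | f z < 0].
have LAE z : (z \in LA) = (0 <= f z) && (z \in X) by rewrite mem_filter.
have LBE z : (z \in LB) = (f z < 0) && (z \in X) by rewrite mem_filter.
have mP x y : x \in LA -> y \in LB -> (x, y) \in [seq (x, y) | x <- LA, y <- LB].
  exact: allpairs_f.
have q2A : q2 \in LA by rewrite LAE ltW.
have q1B : q1 \in LB by rewrite LBE f1.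
have [[x y0] xyL tmax] := seq_argmax _ t _ _ (mP _ _ q2A q1B).
have [xA y0B] : x \in LA /\ y0 \in LB.
  by case/allpairsP: xyL => -[x' y'] /= [? ? [-> ->]].
move: (xA) (y0B); rewrite LAE LBE => /andP[fx xX] /andP[fy0 y0X].
(* If [f x = 0], every [y0] gives the same [t], so maximality alone does not determine the edge;
   turning about [x] picks a [y] that also supports the points with negative [f]. *)
have [|y yB yP] := angular_extreme 1 (d.1 - p.1, d.2 - p.2) x _ _ y0B.
  move=> z; rewrite LBE => /andP[fz _] /=.
  have -> : (z.1 - x.1) * (d.2 - p.2) - (z.2 - x.2) * (d.1 - p.1) = f z - f x.
    by rewrite /f /cross; ring.
  by rewrite subr_lt0 (lt_le_trans fz).
move: (yB); rewrite LBE => /andP[fy yX].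
have D0 : 0 < f x - f y0 by lra.
have D1 : 0 < f x - f y by lra.
have txy0 : 0 < cross p x y0.
  have := tmax _ (mP _ _ q2A q1B); rewrite /t /= => h.
  have : 0 < cross p x y0 / (f x - f y0).
    by apply: lt_le_trans h; rewrite divr_gt0 //; lra.
  by rewrite pmulr_lgt0 // invr_gt0.
have ty : (f x - f y) * cross p x y0 <= (f x - f y0) * cross p x y.
  rewrite -subr_ge0.
  have -> : (f x - f y0) * cross p x y - (f x - f y) * cross p x y0 =
            f x * cross x y y0 by rewrite /f /cross; ring.
  by rewrite mulr_ge0 //; have := yP y0 y0B; rewrite mul1r.
have txy : 0 < cross p x y.
  by rewrite -(pmulr_rgt0 _ D0); apply: lt_le_trans ty; rewrite mulr_gt0.
exists x, y; split=> //; first by rewrite fy fx.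
move=> z zX; case: (ltrP (f z) 0) => fz.
  by have := yP z; rewrite LBE fz zX mul1r => /(_ isT).
have zA : z \in LA by rewrite LAE fz.
have := tmax _ (mP _ _ zA yB); rewrite /t /= => h.
have D2 : 0 < f z - f y by lra.
have {}h : (f x - f y) * cross p z y <= (f z - f y) * cross p x y.
  have h2 : cross p x y0 / (f x - f y0) <= cross p x y / (f x - f y).
    by rewrite ler_pdivrMr // mulrAC ler_pdivlMr // mulrC [leRHS]mulrC.
  have := le_trans h h2.
  by rewrite ler_pdivrMr // mulrAC ler_pdivlMr // mulrC [leRHS]mulrC.
have E : (f z - f y) * cross p x y - (f x - f y) * cross p z y = - f y * cross x y z.
  by rewrite /f /cross; ring.
have fy' : 0 < - f y by lra.
by rewrite -(pmulr_rge0 _ fy') -E subr_ge0.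
Qed.

(* [A / K], [B / K] are the coordinates of a point [q] in the basis [x, y];
   [A + B <= K] places [q] below the line [xy], and [f] measures the side of
   [q] with respect to a ray crossing the segment [xy]. *)
Lemma height_le (K A B fx fy cx cy : R) : 0 < K -> A + B <= K ->
  0 <= fx -> fy <= 0 -> A * fx + B * fy < 0 -> 0 <= cx -> 0 <= cy ->
  K * cx <= A * cx + B * cy -> cx <= cy.
Proof.
move=> K0 AB fx0 fy0 fq cx0 cy0 hq; rewrite leNgt; apply/negP => cyx.
case: (ltrP B 0) => B0.
  have A0 : A < 0 by rewrite ltNge; apply/negP => A0; nra.
  nra.
case: (ltrP A 0) => A0; first nra.
have B1 : B = 0 by apply/le_anti; rewrite B0 andbT; nra.
by move: fq; rewrite B1 mul0r addr0 ltNge mulr_ge0.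
Qed.

(** Applied to [q1] and [q2], [height_le] shows that moving from [p] along [r - p] or [l - p] does
    not raise the height over [xy]. All of [X] lies in the cone at [p] spanned by these
    directions. *)
Lemma crossing_tallest X p d r l q1 q2 x y :
  let f z := cross p z d in
  0 < cross p r l -> p \in X ->
  (forall z, z \in X -> 0 <= cross p r z) ->
  (forall z, z \in X -> 0 <= cross p z l) ->
  q1 \in X -> (forall z, z \in X -> cross p r z <= cross p r q1) -> f q1 < 0 ->
  q2 \in X -> (forall z, z \in X -> cross p z l <= cross p q2 l) -> 0 < f q2 ->
  x \in X -> y \in X -> f y < 0 <= f x -> 0 < cross p x y ->
  (forall z, z \in X -> 0 <= cross x y z) ->
  forall z, z \in X -> cross x y z <= cross x y p.
Proof.
move=> f W0 pX cr cl q1X q1P f1 q2X q2P f2 xX yX /andP[fy fx] K0 xy z zX.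
have AB q : q \in X -> cross p q y + cross p x q <= cross p x y.
  by move=> /xy; rewrite /cross; lra.
have hr : cross p r x <= cross p r y.
  apply: (height_le (cross p x y) (cross p q1 y) (cross p x q1) (f x) (f y)) => //.
  - exact: AB.
  - exact: ltW.
  - have -> : cross p q1 y * f x + cross p x q1 * f y = cross p x y * f q1.
      by rewrite /f /cross; ring.
    by rewrite pmulr_rlt0.
  - exact: cr.
  - exact: cr.
  - have -> : cross p q1 y * cross p r x + cross p x q1 * cross p r y =
              cross p x y * cross p r q1 by rewrite /cross; ring.
    by rewrite ler_pM2l // q1P.
have hl : cross p y l <= cross p x l.
  apply: (height_le (cross p x y) (cross p x q2) (cross p q2 y) (- f y) (- f x)) => //.
  - by rewrite addrC; exact: AB.
  - by rewrite oppr_ge0 ltW.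
  - by rewrite oppr_le0.
  - have -> : cross p x q2 * - f y + cross p q2 y * - f x = - (cross p x y * f q2).
      by rewrite /f /cross; ring.
    by rewrite oppr_lt0 mulr_gt0.
  - exact: cl.
  - exact: cl.
  - have -> : cross p x q2 * cross p y l + cross p q2 y * cross p x l =
              cross p x y * cross p q2 l by rewrite /cross; ring.
    by rewrite ler_pM2l // q2P.
rewrite -(ler_pM2l W0) -subr_ge0.
have -> : cross p r l * cross x y p - cross p r l * cross x y z =
   cross p z l * (cross p r y - cross p r x) + cross p r z * (cross p x l - cross p y l).
  by rewrite /cross; ring.
by rewrite addr_ge0 // mulr_ge0 ?cr ?cl ?subr_ge0.
Qed.

Lemma tallest_triangles_admissible X O : convex_position X -> ~ collinear X ->
  (forall a b c, tallest X a b c -> admissible [:: a; b; c] O) -> admissible X O.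
Proof.
move=> cvx ncol adm; apply/admissibleP => p pX intp.
have [_ []] := cvx p pX; apply: interior_conv => u u0.
apply/negPn; rewrite -all_predC; apply/negP => /allP up.
have {}up z : z \in X -> dot u z <= dot u p by move=> /up /=; rewrite -leNgt.
have n10 : (-1 : R) != 0 by rewrite oppr_eq0 oner_eq0.
have [r [spr rP]] := side_neighbour X p u 1 ncol pX u0 up (oner_neq0 _).
have [l [spl lP]] := side_neighbour X p u (-1) ncol pX u0 up n10.
have [q1 q1X q1P] := seq_argmax _ (fun z => 1 * cross p r z) X p pX.
have [q2 q2X q2P] := seq_argmax _ (fun z => -1 * cross p l z) X p pX.
have [K1 f1] := tallest_corner X O p r q1 1 ncol adm intp (oner_neq0 _) spr rP q1X q1P.
have [K2 f2] := tallest_corner X O p l q2 (-1) ncol adm intp n10 spl lP q2X q2P.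
have clE z : cross p z l = -1 * cross p l z by rewrite /cross; ring.
have crE z : cross p r z = 1 * cross p r z by rewrite mul1r.
have lX : l \in X by case: spl.
have rX : r \in X by case: spr.
pose d := pt_refl O p; rewrite -/d in f1 f2.
have W0 : 0 < cross p r l.
  rewrite lt0r crE rP // andbT mul1r; apply/eqP => W.
  (* [l] and [r] are aligned with [p], so [q1] is tallest for both sides. *)
  have q1P' z : z \in X -> -1 * cross p l z <= -1 * cross p l q1.
    move=> zX; rewrite -(ler_pM2l K1).
    have -> : 1 * cross p r q1 * (-1 * cross p l z) =
              1 * cross p r z * (-1 * cross p l q1) + cross p r l * cross p z q1.
      by rewrite /cross; ring.
    by rewrite W mul0r addr0 ler_wpM2r ?lP // q1P.
  have [_ f1'] := tallest_corner X O p l q1 (-1) ncol adm intp n10 spl lP q1X q1P'.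
  by move: f1 f1'; rewrite -/d; lra.
have {}f1 : cross p q1 d < 0 by rewrite -[cross _ _ _]mul1r.
have {}f2 : 0 < cross p q2 d by lra.
(* Maximality of [q1] and [q2] gives the weak inequality. Equality would put both on one ray from
   [p], although [d] separates them strictly. *)
have q21 : 0 < cross p q2 q1.
  have h : 0 <= cross p r l * cross p q2 q1.
    have -> : cross p r l * cross p q2 q1 =
       cross p q2 l * (1 * cross p r q1 - 1 * cross p r q2) +
       cross p r q2 * ((-1 * cross p l q2) - (-1 * cross p l q1)).
      by rewrite /cross; ring.
    apply: addr_ge0; apply: mulr_ge0.
    - by rewrite clE lP.
    - by rewrite subr_ge0 q1P.
    - by rewrite crE rP.
    - by rewrite subr_ge0 q2P.
  rewrite lt0r -(pmulr_rge0 _ W0) h andbT; apply/eqP => e.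
  have E : cross p r q1 * cross p q2 d - cross p r q2 * cross p q1 d =
           cross p r d * cross p q2 q1 by rewrite /cross; ring.
  move: E; rewrite e mulr0 => /eqP; rewrite subr_eq0 => /eqP E.
  have : 0 < cross p r q1 * cross p q2 d by rewrite mulr_gt0 // crE.
  by rewrite E ltNge mulr_ge0_le0 // ?(ltW f1) // crE rP.
have [x0 [y0 [x0X y0X fxy0 K0 xy0]]] := bridge X p d q1 q2 q1X q2X f1 f2 q21.
(* [v] is normal to [pd], so the passage to consecutive endpoints keeps them on opposite sides of
   the ray. *)
pose v : pt := (d.2 - p.2, - (d.1 - p.1)).
have FE z : dot v z - dot v p = cross p z d by rewrite /v /dot /cross /=; ring.
have [||x [y [sxy fxy _ _ [k k0 kE]]]] :=
  side_crossing X x0 y0 v (dot v p) 1 (oner_neq0 _) x0X y0X.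
- by rewrite !FE.
- by move=> z /xy0; rewrite mul1r.
move: fxy; rewrite !FE => fxy.
have xy z : z \in X -> 0 <= cross x y z.
  by move=> /xy0 h; rewrite kE mulr_ge0 // ltW.
have Kp : 0 < cross x y p.
  by rewrite kE mulr_gt0 //; move: K0; rewrite /cross; lra.
have K : 0 < cross p x y by move: Kp; rewrite /cross; lra.
have [xX yX xny _ _] := sxy.
have top : forall z, z \in X -> cross x y z <= cross x y p.
  apply: (crossing_tallest X p d r l q1 q2) => //.
  - by move=> z zX; rewrite crE rP.
  - by move=> z zX; rewrite clE lP.
  - by move=> z zX; rewrite crE [leRHS]crE q1P.
  - by move=> z zX; rewrite !clE q2P.
(* Some point of the doubled set is higher over [xy] than [p]. It is the reflection of a point of
   [X], which forces [d] to have positive height. *)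
have fd : cross p x d + cross p d y < cross p x y.
  have /(interior_conv_dot _ _ _ intp)/hasP[z zS hz] :
      ((- (y.2 - x.2), y.1 - x.1) : pt) != (0, 0).
    rewrite xpair_eqE oppr_eq0 negb_and; exact: normal_neq0.
  move: zS; rewrite mem_cat_refl_set => /orP[] zX.
    by have := top z zX; move: hz; rewrite /dot /cross /=; lra.
  by have := xy _ zX; move: hz; rewrite /d /dot /cross /pt_refl /=; lra.
have /andP[fy fx] := fxy.
(* By [fxy] both coordinates of [d] are nonnegative, so the bound [fd] on their sum bounds each of
   them. *)
apply: (triangle_not_admissible [:: x; y; p] O p y x 1); rewrite -?/d ?mul1r //.
- by rewrite !inE !eqxx !orbT.
- by move: fy fd; rewrite /cross; lra.
- by move: fx fd; rewrite /cross; lra.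
- apply: adm; apply: (tallest_max X x y p 1 (oner_neq0 _)) => // w wX.
  by rewrite !mul1r xy ?top.
Qed.

End TallestTriangles.

Theorem mainTheorem6 (R : rcfType) (X : seq (R * R)%type) :
  convex_position X -> ~ collinear X ->
  forall O : (R * R)%type,
    admissible X O <->
    (forall a b c, tallest X a b c -> admissible [:: a; b; c] O).
Proof.
move=> cvx ncol O; split=> [adm a b c [[aX bX _ _ _] [cX _]]|].
  apply: admissible_subset adm => z; rewrite !inE.
  by case/or3P => /eqP ->.
exact: tallest_triangles_admissible.
Qed.
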